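(* Let $n\ge 2$ be an integer and let $D_n$ be the dihedral group of order $2n$. Every Haar graph $H(D_n,S)$, $S\subseteq D_n$ (a graph of order $4n$), is a Cayley graph if and only if $n\in\{2,3,4,5\}$.
   Context: All groups and graphs are finite and graphs are undirected. For a group $G$ and an arbitrary subset $S\subseteq G$, the Haar graph $H(G,S)$ is the graph with vertex set $G\times\{0,1\}$ and edges $[(x,0),(sx,1)]$ for $x\in G$, $s\in S$. For a group $A$ and a subset $T\subseteq A$ with $1_A\notin T$ and $T=T^{-1}$, the Cayley graph $\mathrm{Cay}(A,T)$ has vertex set $A$ and edges $[x,tx]$ for $x\in A$, $t\in T$. A graph $X$ is called a Cayley graph if it is isomorphic to some $\mathrm{Cay}(A,T)$ (equivalently, by Sabidussi, $\operatorname{Aut} X$ contains a subgroup acting regularly on the vertex set). $D_n$ denotes the dihedral group of order $2n$ for $n\ge2$, so $D_2\cong\mathbb{Z}_2^2$ is the Klein four-group. *)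

(* Defs.v *)
From HB Require Import structures.
From mathcomp Require Import all_boot all_fingroup all_solvable.

Set Implicit Arguments.
Unset Strict Implicit.
Unset Printing Implicit Defensive.

Local Open Scope group_scope.

(* A finite undirected graph is its adjacency relation on a finType of
   vertices; the symmetry and irreflexivity of the relations built below are
   checked by the lemmas at the end of the file. *)
Definition graph_isomorphic (V W : finType) (e : rel V) (f : rel W) : Prop :=
  exists2 h : V -> W, bijective h & forall x y, f (h x) (h y) = e x y.

(* The layers 0 and 1 of G x {0,1} are encoded by [false] and [true]. *)
Definition haar_arc (gT : finGroupType) (S : {set gT}) : rel (gT * bool) :=
  fun u v =>
    [exists x : gT, exists s in S, (u == (x, false)) && (v == (s * x, true))].

Definition haar_graph (gT : finGroupType) (S : {set gT}) : rel (gT * bool) :=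
  fun u v => haar_arc S u v || haar_arc S v u.

(* Only used with 1 \notin T and T^-1 = T; see [is_cayley_graph]. *)
Definition cayley_graph (gT : finGroupType) (T : {set gT}) : rel gT :=
  fun x y => [exists t in T, y == t * x].

Definition is_cayley_graph (V : finType) (e : rel V) : Prop :=
  exists (aT : finGroupType) (T : {set aT}),
    [/\ 1 \notin T, [set t^-1 | t in T] = T
      & graph_isomorphic e (cayley_graph T)].

Lemma haar_graph_sym (gT : finGroupType) (S : {set gT}) :
  symmetric (haar_graph S).
Proof. by move=> u v; rewrite /haar_graph orbC. Qed.

Lemma haar_graph_irr (gT : finGroupType) (S : {set gT}) :
  irreflexive (haar_graph S).
Proof.
move=> u; rewrite /haar_graph orbb; apply/existsP => -[x /existsP[s]].
by case/and3P=> _ /eqP-> /eqP[].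
Qed.

Lemma cayley_graph_sym (gT : finGroupType) (T : {set gT}) :
  [set t^-1 | t in T] = T -> symmetric (cayley_graph T).
Proof.
move=> TV; have sub x y : cayley_graph T x y -> cayley_graph T y x.
  case/existsP=> t /andP[Tt /eqP->]; apply/existsP; exists t^-1.
  by rewrite -TV imset_f // mulKg eqxx.
by move=> x y; apply/idP/idP; apply: sub.
Qed.

Lemma cayley_graph_irr (gT : finGroupType) (T : {set gT}) :
  1 \notin T -> irreflexive (cayley_graph T).
Proof.
move=> T1 x; apply/existsP => -[t /andP[Tt]]; rewrite eq_sym -{2}[x]mul1g.
by move/eqP/mulIg=> t1; rewrite -t1 Tt in T1.
Qed.

(* Main.v *)
Require Import Defs.
From HB Require Import structures.
From mathcomp Require Import all_boot all_fingroup all_solvable.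

(** Both directions rest on the following about [D_n]: the rotations form a
    cyclic subgroup [A] of index 2 and order [n], and every element outside
    [A], a reflection, is an involution. Conjugation by a reflection then
    inverts [A].

    If [n] is at most 5, every Haar graph is Cayley. Suppose that [f] is an
    involutive automorphism of [G] with [f(S) = S^-1]. Then the map exchanging
    [(x,0)] and [(f x,1)] is an automorphism of [H(G,S)], and together with
    the right translations by [G] it generates a group acting regularly on the
    vertices ([haar_twist_cayley]). For reflections [r] and [r'], such an [f]
    is obtained by inverting [A] and sending a reflection [s] to [r s r']; as
    reflections are their own inverses, [f(S) = S^-1] means that the set of
    reflections in [S] is stable under [s |-> r s r']. If there are at most two
    reflections in [S], let [r] and [r'] be these: they are exchanged, or fixed
    if there is only one. Otherwise at most two reflections lie outside [S],
    and a permutation that preserves their set also preserves its complement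
    ([haar_cayley_small]).

    If [n] is at least 6, some Haar graph is not even vertex-transitive.
    The number of vertices reached by walks of length two is [|S^-1 S|] from a
    vertex in layer 0 and [|S S^-1|] from one in layer 1
    ([cayley_haar_card_eq]). For [S] the union of [C] and [C r], where [C] is a
    set of rotations and [r] a reflection, these numbers are [2 |C C^-1|] and
    [|C C^-1| + |C C|] ([haar_doubled_card]), so it is enough to have
    [|C C| <> |C C^-1|]. In additive notation, [C = {0, 1, 3}] has
    [C + C = {0, 1, 2, 3, 4, 6}], while the translate [3 + (C - C)] is
    [{0, 1, 2, 3, 4, 5, 6}]; modulo [n >= 6] the residue 5 is in the second
    set and not in the first ([card_sumset_lt_diffset]). *)

Set Implicit Arguments.
Unset Strict Implicit.
Unset Printing Implicit Defensive.

Local Open Scope group_scope.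

(** * Adjacency in Cayley graphs and Haar graphs *)

Lemma cayley_graphE (gT : finGroupType) (T : {set gT}) x y :
  cayley_graph T x y = (y * x^-1 \in T).
Proof.
apply/existsP/idP=> [[t /andP[Tt /eqP->]] | Tyx]; first by rewrite mulgK.
by exists (y * x^-1); rewrite Tyx mulgKV /=.
Qed.

Lemma haar_arcE (gT : finGroupType) (S : {set gT}) x i y j :
  haar_arc S (x, i) (y, j) = [&& ~~ i, j & y * x^-1 \in S].
Proof.
apply/existsP/and3P=> [[z /existsP[s /and3P[Ss /eqP[-> ->] /eqP[-> ->]]]] | ].
  by rewrite mulgK.
case=> /negbTE-> -> Syx; exists x; apply/existsP; exists (y * x^-1).
by rewrite Syx mulgKV !eqxx.
Qed.

Lemma haar_graphE (gT : finGroupType) (S : {set gT}) x i y j :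
  haar_graph S (x, i) (y, j)
    = (i != j) && ((if i then x * y^-1 else y * x^-1) \in S).
Proof. by rewrite /haar_graph !haar_arcE; case: i; case: j; rewrite ?orbF. Qed.

(** * Walks of length two *)

(** The number of endpoints of such walks tells the two layers of a Haar graph
    apart; counting walks would not, as both layers have equally many. *)
Definition two_step (V : finType) (e : rel V) (v : V) : {set V} :=
  [set w | [exists u, e v u && e u w]].

Lemma two_stepP (V : finType) (e : rel V) v w :
  reflect (exists u, e v u && e u w) (w \in two_step e v).
Proof. by rewrite inE; apply: existsP. Qed.

Lemma card_two_step_iso (V W : finType) (e : rel V) (f : rel W) (h : V -> W) v :
    bijective h -> (forall x y, f (h x) (h y) = e x y) ->
  #|two_step f (h v)| = #|two_step e v|.
Proof.
move=> bij_h fh; have [k hK kK] := bij_h.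
rewrite -(card_imset _ (bij_inj bij_h)).
congr #|pred_of_set _|; apply/setP=> w; rewrite -[w]kK.
rewrite (mem_imset _ _ (bij_inj bij_h)).
apply/two_stepP/two_stepP=> [[u] | [u]]; last by exists (h u); rewrite !fh.
by exists (k u); rewrite -!fh kK.
Qed.

Lemma card_two_step_cayley (gT : finGroupType) (T : {set gT}) v :
  #|two_step (cayley_graph T) v| = #|T * T|.
Proof.
rewrite -[RHS](card_rcoset _ v); congr #|pred_of_set _|; apply/setP=> w.
rewrite mem_rcoset; apply/two_stepP/idP=> [[u] | /mulsgP[t s Tt Ts wv]].
  rewrite !cayley_graphE => /andP[Tu Tw].
  by rewrite -[w](mulgKV u) -mulgA mem_mulg.
by exists (s * v); rewrite !cayley_graphE invMg mulgA mulgK wv mulgK Ts Tt.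
Qed.

Lemma card_two_step_haar (gT : finGroupType) (S : {set gT}) i :
  #|two_step (haar_graph S) (1, i)| = #|if i then S * S^-1 else S^-1 * S|.
Proof.
have inj_i : injective (fun x : gT => (x, i)) by move=> x y [].
rewrite -(card_imset _ inj_i); congr #|pred_of_set _|; apply/setP=> -[w j].
apply/two_stepP/imsetP=> [[[u k]] | [g Sg [-> ->]]].
  rewrite !haar_graphE => /andP[/andP[ik Su] /andP[kj Sw]].
  have ij : i = j by case: (i) (j) (k) ik kj => [] [] [].
  subst j; exists w => //; case: i k ik kj Su Sw {inj_i} => [] [] //= _ _.
    rewrite mul1g -[w in X in _ -> _ -> X](mulgKV u) => Su Sw.
    by rewrite mem_mulg // inE.
  rewrite invg1 mulg1 -[w in X in _ -> _ -> X](mulgKV u) => Su Sw.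
  by rewrite mem_mulg // inE invMg invgK.
case: i Sg {inj_i} => /mulsgP[x y].
  rewrite inE => Sx Sy ->; exists (y, false); rewrite !haar_graphE /=.
  by rewrite mul1g mulgK Sx Sy.
rewrite inE => Sx Sy ->; exists (y, true); rewrite !haar_graphE /=.
by rewrite invMg mulgA invg1 mulg1 mulgV mul1g Sx Sy.
Qed.

(** A Cayley graph is vertex-transitive, so [two_step] has the same size at a
    vertex of layer 0 and at one of layer 1. *)
Lemma cayley_haar_card_eq (gT : finGroupType) (S : {set gT}) :
  is_cayley_graph (haar_graph S) -> #|S * S^-1| = #|S^-1 * S|.
Proof.
case=> aT [T [_ _ [h bij_h hE]]].
rewrite -(card_two_step_haar S true) -(card_two_step_haar S false).
by rewrite -!(card_two_step_iso _ bij_h hE) !card_two_step_cayley.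
Qed.

(** * Haar graphs with an involutive automorphism sending S to its inverse *)

Section TwistedDouble.

Variables (gT : finGroupType) (f : gT -> gT).
Hypotheses (fM : {morph f : x y / x * y}) (fK : involutive f).

(** The semidirect product of [gT] by the group of order 2 acting through [f],
    on the vertex set of the Haar graphs. The product is arranged so that right
    multiplication by [(h, false)] is [(x, i) |-> (x * h, i)], the translation,
    and right multiplication by [(1, true)] is [(x, i) |-> (f x, ~~ i)]. *)
Definition twisted_double of {morph f : x y / x * y} & involutive f : Type :=
  (gT * bool)%type.

Local Notation D := (twisted_double fM fK).

HB.instance Definition _ := Finite.on D.

Let twist (j : bool) (x : gT) := if j then f x else x.
Let dmul (u v : D) : D := (twist v.2 u.1 * v.1, u.2 (+) v.2).
Let dunit : D := (1, false).
Let dinv (u : D) : D := (twist u.2 u.1^-1, u.2).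

Let f1 : f 1 = 1.
Proof. by apply: (mulgI (f 1)); rewrite -fM !mulg1. Qed.

Let dmulA : associative dmul.
Proof.
move=> [x i] [y j] [z k]; rewrite /dmul /= addbA mulgA; congr (_ * _, _).
by case: i; case: j; case: k; rewrite //= fM ?fK.
Qed.

Let dmul1 : left_id dunit dmul.
Proof. by move=> [x [|]]; rewrite /dmul /= ?f1 mul1g. Qed.

Let dmulV : left_inverse dunit dinv dmul.
Proof.
by move=> [x [|]]; rewrite /dmul /dinv /= ?fK ?mulVg.
Qed.

HB.instance Definition _ := Finite_isGroup.Build D dmulA dmul1 dmulV.

Let fV x : f x^-1 = (f x)^-1.
Proof. by apply: (mulgI (f x)); rewrite -fM !mulgV f1. Qed.

(** With the group law above the Haar graph is literally a Cayley graph: the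
    identity is the isomorphism, and the connection set consists of the
    neighbours [(s, true)] of the unit. *)
Lemma haar_twist_cayley (S : {set gT}) :
  (forall s, s \in S -> (f s)^-1 \in S) -> is_cayley_graph (haar_graph S).
Proof.
move=> fS; have fVS s : ((f s)^-1 \in S) = (s \in S).
  by apply/idP/idP=> /fS //; rewrite fV invgK fK.
pose T : {set D} := [set u | u.2 & u.1 \in S].
exists D, T; split.
- by rewrite inE.
- have TV (u : D) : u \in T -> u^-1 \in T.
    by case: u => x [|]; rewrite !inE //= fV => /fS.
  apply/setP=> u; apply/imsetP/idP=> [[v Tv ->] | Tu]; first exact: TV.
  by exists u^-1; rewrite ?invgK ?TV.
exists (fun u : gT * bool => u : D); first by exists id.
move=> [x i] [y j]; rewrite cayley_graphE haar_graphE inE.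
case: i => /=; last by case: j.
by rewrite -[x * _ \in S]fVS -fV invMg invgK fM; case: j.
Qed.

End TwistedDouble.

(** * Groups with involutions outside a subgroup of index two *)

Section GeneralizedDihedral.

Variables (gT : finGroupType) (A : {group gT}).
Hypothesis indexA : #|[set: gT] : A| = 2.
Hypothesis reflA : forall r, r \notin A -> r * r = 1.

Lemma exists_refl : exists r, r \notin A.
Proof.
have [eqA | [r]] := set_0Vmem (~: A); last by rewrite inE; exists r.
have AT : A :=: [set: gT] by rewrite -[LHS]setCK eqA setC0.
by have := indexA; rewrite AT indexgg.
Qed.

Lemma refl_inv r : r \notin A -> r^-1 = r.
Proof. by move/reflA=> rr; apply: (mulgI r); rewrite mulgV rr. Qed.

Lemma refl_coset r : r \notin A -> A :* r = ~: A.
Proof.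
by move=> nAr; rewrite (rcoset_index2 (subsetT _) indexA) ?setTD // !inE nAr.
Qed.

Lemma card_refl : #|~: A| = #|A|.
Proof.
by have [r nAr] := exists_refl; rewrite -(refl_coset nAr) card_rcoset.
Qed.

Lemma mem_mul_index2 x y : (x * y \in A) = ((x \in A) == (y \in A)).
Proof.
have [Ax | nAx] := boolP (x \in A); first by rewrite groupMl //= eqb_id.
have [Ay | nAy] := boolP (y \in A); first by rewrite groupMr // (negbTE nAx).
by have := nAx; rewrite -in_setC -(refl_coset nAy) mem_rcoset refl_inv.
Qed.

(** Because [r * x] is again a reflection, hence an involution. *)
Lemma refl_conj r x : r \notin A -> x \in A -> r * x * r = x^-1.
Proof.
move=> nAr Ax; have nArx : r * x \notin A by rewrite groupMr.
by apply: (mulIg x); rewrite -mulgA reflA // mulVg.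
Qed.

(** Conjugation by a reflection is an automorphism of [A] that inverts every
    element, and inversion is a morphism only on abelian groups. *)
Lemma rot_comm : abelian A.
Proof.
have [r nAr] := exists_refl.
apply/centsP=> x Ax y Ay; apply: invg_inj.
rewrite -(refl_conj nAr) ?groupM // invMg -(refl_conj nAr Ax).
rewrite -[y^-1](refl_conj nAr Ay) !mulgA.
by rewrite -[_ * r * r]mulgA reflA // mulg1.
Qed.

Section Swap.

Variables (r r' : gT).
Hypotheses (nAr : r \notin A) (nAr' : r' \notin A).

(** For [gT] dihedral with rotation [a] and reflection [b], this is the map
    [a |-> a^-1], [b |-> a^t * b], with [t] determined by [r] and [r']. *)
Definition refl_twist x := if x \in A then x^-1 else r * x * r'.

Lemma refl_twistM : {morph refl_twist : x y / x * y}.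
Proof.
(* [r * x * r'] is a reflection, so it equals its inverse. *)
have conjV x : x \notin A -> r * x * r' = r' * x * r.
  move=> nAx.
  rewrite -[LHS]refl_inv ?mem_mul_index2 ?(negbTE nAx, negbTE nAr) //.
  by rewrite !invMg !refl_inv // mulgA.
move=> x y; rewrite /refl_twist mem_mul_index2.
have [Ax | nAx] := boolP (x \in A); have [Ay | nAy] := boolP (y \in A) => /=.
- by rewrite -invMg (centsP rot_comm).
- by rewrite -(refl_conj nAr Ax) !mulgA -[_ * r * r]mulgA reflA // mulg1.
- by rewrite -(refl_conj nAr' Ay) !mulgA -[_ * r' * r']mulgA reflA // mulg1.
rewrite (conjV x nAx) !mulgA -[_ * r * r]mulgA reflA // mulg1.
rewrite -[r' * x * y]mulgA refl_conj // mem_mul_index2.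
by rewrite (negbTE nAx) (negbTE nAy).
Qed.

Lemma refl_twistK : involutive refl_twist.
Proof.
move=> x; rewrite /refl_twist; have [Ax | nAx] := boolP (x \in A).
  by rewrite groupV Ax invgK.
rewrite !mem_mul_index2 (negbTE nAx) (negbTE nAr) (negbTE nAr') /=.
by rewrite !mulgA reflA // mul1g -mulgA reflA // mulg1.
Qed.

(** Only the reflections matter: the twist inverts each rotation, and a
    reflection is its own inverse. *)
Lemma haar_refl_cayley (S : {set gT}) :
    (forall s, s \in S :\: A -> r * s * r' \in S) ->
  is_cayley_graph (haar_graph S).
Proof.
move=> rS; apply: (haar_twist_cayley refl_twistM refl_twistK) => s Ss.
rewrite /refl_twist; have [As | nAs] := ifPn; first by rewrite invgK.
rewrite refl_inv ?rS ?inE ?nAs //.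
by rewrite !mem_mul_index2 (negbTE nAs) (negbTE nAr) (negbTE nAr').
Qed.

End Swap.

(** For [T = {p, q}] the witnesses are [p] and [q] themselves:
    [p * p * q = q] and [p * q * q = p]. *)
Lemma refl_small_set (T : {set gT}) : T \subset ~: A -> #|T| <= 2 ->
  exists r r', [/\ r \notin A, r' \notin A &
                   forall s, s \in T -> r * s * r' \in T].
Proof.
move=> sTA; have nA p : p \in T -> p \notin A.
  by move/(subsetP sTA); rewrite inE.
rewrite leq_eqVlt ltnS leq_eqVlt ltnS leqn0.
case/or3P=> [/cards2P[p [q [_ defT]]] | /cards1P[p defT] | ].
- exists p, q; split; try by rewrite nA // defT !inE eqxx ?orbT.
  have [nAp nAq] : p \notin A /\ q \notin A.
    by split; apply: nA; rewrite defT !inE eqxx ?orbT.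
  move=> s; rewrite defT !inE => /orP[]/eqP->.
    by rewrite reflA // mul1g eqxx orbT.
  by rewrite -mulgA reflA // mulg1 eqxx.
- have nAp : p \notin A by rewrite nA // defT inE.
  exists p, p; split=> // s; rewrite defT inE => /eqP->.
  by rewrite reflA // mul1g set11.
rewrite cards_eq0 => /eqP T0; have [r nAr] := exists_refl.
exists r, r; split=> // s; by rewrite T0 inE.
Qed.

(** There are [#|A| <= 5] reflections, so those in [S] or those not in [S] are
    at most two; the involution [s |-> r * s * r'] of the
    reflections preserves a set if and only if it preserves its complement. *)
Lemma haar_cayley_small (S : {set gT}) :
  #|A| <= 5 -> is_cayley_graph (haar_graph S).
Proof.
move=> A5; have [S2 | S3] := leqP #|S :\: A| 2.
  have [|r [r' [nAr nAr' rT]]] := refl_small_set _ S2.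
    by rewrite setDE subsetIr.
  by apply: (haar_refl_cayley nAr nAr') => s /rT; rewrite inE => /andP[].
have U2: #|~: A :\: S| <= 2.
  have := cardsID S (~: A); rewrite card_refl setIC -setDE => cardA.
  rewrite -(leq_add2l #|S :\: A|) cardA.
  by apply: leq_trans A5 _; rewrite (leq_add S3 (leqnn 2)).
have [|r [r' [nAr nAr' rT]]] := refl_small_set _ U2; first by rewrite subsetDl.
apply: (haar_refl_cayley nAr nAr') => s; rewrite inE => /andP[nAs Ss].
have nArs : r * s * r' \notin A.
  by rewrite !mem_mul_index2 (negbTE nAs) (negbTE nAr) (negbTE nAr').
apply: contraLR Ss => nSrs.
have /rT : r * s * r' \in ~: A :\: S by rewrite !inE nSrs nArs.
by rewrite !mulgA reflA // mul1g -mulgA reflA // mulg1 inE => /andP[].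
Qed.

(** With [S = C :|: C :* r], the rotations in [S * S^-1] and in [S^-1 * S] are
    the same, namely [C * C^-1], whereas the reflections are [C * C :* r] in
    the former and [C * C^-1 :* r] in the latter. *)
Lemma haar_doubled_card (C : {set gT}) r :
    C \subset A -> r \notin A -> is_cayley_graph (haar_graph (C :|: C :* r)) ->
  #|C * C| = #|C * C^-1|.
Proof.
move=> sCA nAr /cayley_haar_card_eq.
have sCVA : C^-1 \subset A by rewrite -(invGid A) invSg.
have conjC (B : {set gT}) : B \subset A -> [set r] * B = B^-1 * [set r].
  move=> sBA; apply/setP=> x; rewrite mem_lcoset mem_rcoset inE invMg invgK.
  rewrite refl_inv //; apply/idP/idP=> Bx; have /= := subsetP sBA _ Bx;
    rewrite mem_mul_index2 (negbTE nAr) ?groupV;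
    case: (boolP (x \in A)) => // nAx _;
    by move: Bx; rewrite refl_inv.
have mulR (B E : {set gT}) : B \subset A -> E :* r * B = E * B^-1 :* r.
  by move=> sBA; rewrite -!mulgA conjC.
have mulRR (B E : {set gT}) : B \subset A -> E :* r * (B :* r) = E * B^-1.
  by move=> sBA; rewrite mulgA mulR // -mulgA mulg_set1 reflA // mulg1.
have CC : C^-1 * C = C * C^-1.
  by apply: centC; apply: subset_trans sCVA (subset_trans rot_comm (centS sCA)).
have -> : (C :|: C :* r)^-1 = C^-1 :|: C :* r.
  by rewrite invUg invMg invg_set1 refl_inv // conjC // invgK.
rewrite !mulgU !mulUg !mulRR // !mulR // !mulgA CC invgK.
have cardU (B E : {set gT}) : B \subset A -> E \subset A ->
    #|B :|: E :* r :|: (E :* r :|: B)| = (#|B| + #|E|)%N.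
  move=> sBA sEA; rewrite [E :* r :|: B]setUC setUid cardsU card_rcoset.
  suff -> : B :&: E :* r = set0 by rewrite cards0 subn0.
  apply/setP=> x; rewrite !inE; apply/negP=> /andP[/(subsetP sBA) Ax].
  rewrite mem_rcoset => /(subsetP sEA) /=.
  by rewrite mem_mul_index2 Ax groupV (negbTE nAr).
have sCC : C * C \subset A by rewrite -(mulGid A) mulgSS.
have sCCV : C * C^-1 \subset A by rewrite -(mulGid A) mulgSS.
by rewrite !cardU // => /addnI.
Qed.

End GeneralizedDihedral.

(** * A set with fewer products than quotients *)

Definition three_powers (gT : finGroupType) (a : gT) : {set gT} :=
  [set 1; a; a ^+ 3].

(** The translate [a ^+ 3 *: (C * C^-1)] contains [a ^+ k] for all [k <= 6],
    and [C * C] is the same without [k = 5]. These differ as soon as 5 is not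
    congruent to any of 0, 1, 2, 3, 4, 6 modulo the order of [a]. *)
Lemma card_sumset_lt_diffset (gT : finGroupType) (a : gT) :
    5 < #[a] ->
  #|three_powers a * three_powers a| < #|three_powers a * (three_powers a)^-1|.
Proof.
move=> a_gt5; set C := three_powers a.
have Cpow i : i \in [:: 0; 1; 3]%N -> a ^+ i \in C.
  by rewrite !inE => /or3P[]/eqP->; rewrite ?eqxx ?orbT.
have powC x : x \in C -> exists2 i, i \in [:: 0; 1; 3]%N & x = a ^+ i.
  by rewrite !inE -orbA => /or3P[]/eqP->; [exists 0 | exists 1%N | exists 3].
have diff k i j :
    i \in [:: 0; 1; 3]%N -> j \in [:: 0; 1; 3]%N -> (k + j = 3 + i)%N ->
  a ^+ k \in a ^+ 3 *: (C * C^-1).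
  move=> Ci Cj /(congr1 (expgn a)); rewrite !expgD => eq_a.
  rewrite mem_lcoset -[a ^+ k](mulgK (a ^+ j)) eq_a -(mulgA (a ^+ 3)) mulKg.
  by rewrite mem_mulg ?Cpow // inE invgK Cpow.
have sums x : x \in C * C ->
  exists2 k, k \in [:: 0; 1; 2; 3; 4; 6]%N & x = a ^+ k.
  case/mulsgP=> _ _ /powC[i Ci ->] /powC[j Cj ->] ->; exists (i + j)%N.
    by move: Ci Cj; rewrite !inE => /or3P[]/eqP-> /or3P[]/eqP->.
  by rewrite expgD.
rewrite -(card_lcoset (C * C^-1) (a ^+ 3)); apply/proper_card/properP; split.
  apply/subsetP=> _ /sums[k + ->]; rewrite !inE.
  case/or4P=> [/eqP->|/eqP->|/eqP->|/or3P[]/eqP->].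
  - exact: (diff 0%N 0%N 3%N).
  - exact: (diff 1%N 1%N 3%N).
  - exact: (diff 2%N 0%N 1%N).
  - exact: (diff 3%N 0%N 0%N).
  - exact: (diff 4%N 1%N 0%N).
  - exact: (diff 6%N 3%N 0%N).
exists (a ^+ 5); first exact: (diff 5%N 3%N 1%N).
apply/negP=> /sums[k Ck /eqP]; rewrite eq_expg_mod_order.
move: Ck; rewrite !inE modn_small //.
case/or4P=> [/eqP->|/eqP->|/eqP->|/or3P[]/eqP->]; last first.
  (* When the order is 6, the exponent 6 is congruent to 0. *)
  have [<- // | n_neq6] := eqVneq 6 #[a].
  by rewrite modn_small // ltn_neqAle n_neq6.
all: by rewrite modn_small // (leq_trans _ a_gt5).
Qed.

(** * Dihedral groups *)

Lemma dihedral_rotations n : 1 < n -> exists a : 'D_(2 * n),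
  [/\ #[a] = n, #|[set: 'D_(2 * n)] : <[a]>| = 2
    & forall r, r \notin <[a]> -> r * r = 1].
Proof.
rewrite mul2n => n_gt1.
have /existsP[[a b] /= /eqP[defD an b2 ab]] := isoGrp_hom (Grp_dihedral n_gt1).
have nab : <[b]> \subset 'N(<[a]>).
  by rewrite norms_cycle ab groupV cycle_id.
rewrite norm_joinEr // in defD.
(* The order [2n] of the group forces the generators, of order at most [n] and
   2, to have exactly these orders. *)
have card_ab : n.*2 <= #[a] * #[b].
  have := mul_cardG <[a]> <[b]>; rewrite defD card_dihedral // -!orderE => ->.
  by rewrite leq_pmulr // cardG_gt0.
have leb : #[b] <= 2 by rewrite dvdn_leq // order_dvdn b2.
have oa : #[a] = n.
  apply/eqP; rewrite eqn_leq dvdn_leq ?(ltnW n_gt1) ?order_dvdn ?an //=.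
  rewrite -leq_double; apply: leq_trans card_ab _.
  by have := leq_mul (leqnn #[a]) leb; rewrite muln2.
exists a; split=> //.
  rewrite -divgS ?subsetT // card_dihedral // -orderE oa -muln2.
  by rewrite mulKn // ltnW.
move=> r; have: r \in [set: 'D_n.*2] by [].
rewrite -defD => /mulsgP[_ _ /cycleP[i ->] /cycleP[j ->] ->].
rewrite -(expg_mod j b2) modn2; case: (odd j); last first.
  by rewrite mulg1 mem_cycle.
have bb : b * b = 1 by rewrite -b2 expgS expg1.
have bV : b^-1 = b by apply: (mulgI b); rewrite mulgV bb.
move=> _; rewrite expg1 -mulgA (mulgA b) -[b in X in _ * (X * _)]bV.
rewrite -[b^-1 * _ * b]mulgA -conjgE conjXg ab expgVn.
by rewrite mulgV.
Qed.

Theorem theorem8 (n : nat) (hn : 2 <= n) :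
  (forall S : {set 'D_(2 * n)}, is_cayley_graph (haar_graph S)) <->
  n \in [:: 2; 3; 4; 5].
Proof.
have [a [oa indexA reflA]] := dihedral_rotations hn.
split=> [cayley | n5 S]; last first.
  apply: (haar_cayley_small indexA reflA).
  by rewrite -orderE oa; move: n5; rewrite !inE => /or4P[]/eqP->.
suff n5 : n <= 5.
  by case: n hn n5 {a oa indexA reflA cayley} => [|[|[|[|[|[|]]]]]].
rewrite leqNgt; apply/negP=> n_gt5.
have [r nAr] := exists_refl indexA.
have sCA : three_powers a \subset <[a]>.
  apply/subsetP=> x; rewrite !inE -orbA.
  by case/or3P=> /eqP->; rewrite ?group1 ?cycle_id ?mem_cycle.
have := card_sumset_lt_diffset (a := a); rewrite oa => /(_ n_gt5).
by rewrite (haar_doubled_card indexA reflA sCA nAr (cayley _)) ltnn.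
Qed.
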